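(* Let $p_1\in[0,1]$ and let $PG_n$ be the random pentagonal chain network described in the context. Then for every $n\geq 1$, $$\mathbb{E}\big(Gut(PG_{n})\big)=(72-24p_{1})n^{3}+(72p_{1}-12)n^{2}+(1-48p_{1})n-1.$$
   Context: Random chain network $PG_n$: $PG_1$ is a $5$-cycle (pentagon). For $n\ge 1$, $PG_{n+1}$ is obtained from $PG_n$ by adding a new pentagon $O_{n+1}$ with vertices $x_1,x_2,x_3,x_4,x_5$ in cyclic (clockwise) order and adding one edge joining $x_1$ to a vertex $u_n$ of $PG_n$. The vertex $u_1$ is any vertex of $PG_1$ (all are equivalent). For $n\ge 2$, $u_n$ is a vertex of the last pentagon $O_n$ (whose vertex $x_1$ is the one joined to $u_{n-1}$): with probability $p_1$ one takes $u_n\in\{x_2,x_5\}$ of $O_n$ (the two neighbours of $x_1$ in $O_n$), and with probability $p_2=1-p_1$ one takes $u_n\in\{x_3,x_4\}$ of $O_n$ (the two vertices at distance $2$ from $x_1$ in $O_n$); $p_1,p_2$ do not depend on the step. Thus $PG_n$ has $5n$ vertices. For a graph $G$, $d(v)$ denotes the degree of vertex $v$ and $d(u,v)$ the shortest-path distance. The Gutman index is $Gut(G)=\sum_{\{u,v\}\subseteq V_G} d(u)d(v)\,d(u,v)$, the sum over unordered pairs of distinct vertices. *)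

(* Defs.v *)
From HB Require Import structures.
From mathcomp Require Import all_boot all_order all_algebra.
Set Implicit Arguments. Unset Strict Implicit. Unset Printing Implicit Defensive.
Import Order.TTheory GRing.Theory Num.Theory.

(* Vertices of PG_n are the naturals a < 5*n; vertex a = 5*k + j is the
   vertex x_{j+1} of the pentagon O_{k+1} (k < n, j < 5), so pentagons are
   0-indexed here.  Within a pentagon, x_{j+1} ~ x_{j+2} (indices mod 5).
   [exitpos k] is the position j (0..4) in pentagon k of the vertex u_{k+1}
   to which x_1 of pentagon k+1 is joined. *)

Definition pent_exit (u1 : nat) (ex : nat -> nat) (k : nat) : nat :=
  if k == 0 then u1 else ex k.

Definition pent_link (u1 : nat) (ex : nat -> nat) (a b : nat) : bool :=
  [&& b %/ 5 == (a %/ 5).+1, b %% 5 == 0 & a %% 5 == pent_exit u1 ex (a %/ 5)].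

Definition pent_cyc (a b : nat) : bool :=
  (a %/ 5 == b %/ 5) &&
  ((b %% 5 == (a %% 5).+1 %% 5) || (a %% 5 == (b %% 5).+1 %% 5)).

Definition pent_adj (n u1 : nat) (ex : nat -> nat) (a b : nat) : bool :=
  [&& a < 5 * n, b < 5 * n &
      [|| pent_cyc a b, pent_link u1 ex a b | pent_link u1 ex b a]].

Fixpoint reach (adj : nat -> nat -> bool) (N k u v : nat) : bool :=
  if k is k'.+1 then
    reach adj N k' u v || has (fun w => adj u w && reach adj N k' w v) (iota 0 N)
  else u == v.

(* shortest-path distance: the least k < N with a walk of length <= k
   (for a connected graph on N vertices such k always exists) *)
Definition gdist (adj : nat -> nat -> bool) (N u v : nat) : nat :=
  find (fun k => reach adj N k u v) (iota 0 N).

Definition gdeg (adj : nat -> nat -> bool) (N v : nat) : nat :=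
  count (adj v) (iota 0 N).

Definition gutman (adj : nat -> nat -> bool) (N : nat) : nat :=
  \sum_(0 <= u < N) \sum_(u.+1 <= v < N)
     gdeg adj N u * gdeg adj N v * gdist adj N u v.

(* Random choices: for n >= 2 the vertex u_n of O_n is chosen among
   x_2, x_5 (codes 0,1; total probability p1, each p1/2) and x_3, x_4
   (codes 2,3; total probability p2 = 1 - p1, each p2/2). *)
Definition choice_pos (i : 'I_4) : nat := nth 0 [:: 1; 4; 2; 3] i.

Definition choice_weight (R : fieldType) (p1 : R) (i : 'I_4) : R :=
  if (i < 2)%N then (p1 / 2%:R)%R else ((1 - p1) / 2%:R)%R.

(* c : the choices for u_2, ..., u_{n-1} (the i-th entry of c, 0-indexed,
   is the choice of u_{i+2} in pentagon index i+1) *)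
Definition chain_exit (m : nat) (c : m.-tuple 'I_4) (k : nat) : nat :=
  choice_pos (nth ord0 c k.-1).

Definition GutPG (n u1 : nat) (c : (n - 2).-tuple 'I_4) : nat :=
  gutman (pent_adj n u1 (chain_exit c)) (5 * n).

(* Main.v *)
(** Each pentagon and each bridge of the chain is separated from the rest by
    cut vertices or a cut edge, so d(u, v) is the sum over the pentagons of the
    distances between the projections of u and v to that pentagon, plus the
    number of bridges separating u from v.  Summed against the degrees, the
    pentagon with index m (from 0) contributes
      60 + 144 (n - 1) + 144 m (n - 1 - m) d_m,
    where d_m is the distance from its vertex x_1 to its exit, and the bridge
    following it contributes the product (12 m + 11) (12 (n - 2 - m) + 11) of
    the total degrees of its two sides.  This is affine in the d_m, and
    E d_m = p1 + 2 (1 - p1) = 2 - p1 whenever m (n - 1 - m) <> 0. *)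
Require Import Defs.
From HB Require Import structures.
From mathcomp Require Import all_boot all_order all_algebra.
From mathcomp Require Import zify ring.
Import Order.TTheory GRing.Theory Num.Theory.
Set Implicit Arguments. Unset Strict Implicit. Unset Printing Implicit Defensive.

(** * Graph distance recognised by a potential function *)

Lemma find_leq_iota N d : d < N -> find (leq d) (iota 0 N) = d.
Proof.
move=> ltdN; rewrite -(subnKC ltdN) addSnnS iotaD find_cat size_iota add0n /= leqnn addn0.
case: hasP => // -[x]; rewrite mem_iota add0n /= => ltxd; by rewrite leqNgt ltxd.
Qed.

Section Distance.
Variables (adj : nat -> nat -> bool) (N : nat) (D : nat -> nat -> nat).
Hypothesis D0 : forall u v, u < N -> v < N -> (D u v == 0) = (u == v).
Hypothesis D_adj : forall u v w, u < N -> v < N -> w < N ->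
  adj u w -> D u v <= (D w v).+1.
Hypothesis D_descent : forall u v, u < N -> v < N -> u != v ->
  exists w, [/\ w < N, adj u w & D u v = (D w v).+1].

(** Induction on [k]: an edge lowers [D] towards [v] by at most one, and away from [v] some edge
    lowers it by exactly one. These two properties, with vanishing only on the diagonal,
    characterise the distance. *)
Lemma reachE k u v : u < N -> v < N -> reach adj N k u v = (D u v <= k).
Proof.
move=> + ltvN; elim: k u => [|k IHk] u ltuN /=; first by rewrite leqn0 D0.
rewrite IHk //; apply/orP/idP => [[/leqW //|/hasP[w]]|].
  rewrite mem_iota => /= ltwN /andP[uw]; rewrite IHk // => Dwv.
  exact: leq_trans (D_adj ltuN ltvN ltwN uw) _.
have [<-|neq_uv] := eqVneq u v.
  by left; have/eqP-> : D u u == 0 by rewrite D0.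
have [w [ltwN uw ->]] := D_descent ltuN ltvN neq_uv; rewrite ltnS => Dwv.
by right; apply/hasP; exists w; rewrite ?mem_iota // uw IHk.
Qed.

Lemma gdistE u v : u < N -> v < N -> D u v < N -> gdist adj N u v = D u v.
Proof.
move=> ltuN ltvN ltDN; rewrite -[RHS](find_leq_iota ltDN).
by apply: eq_find => k; rewrite reachE.
Qed.

End Distance.

(** * Rearrangement of double sums and of sums over pentagons *)

Lemma sum_sym_pairs N (g : nat -> nat -> nat) :
    (forall u v, g u v = g v u) -> (forall u, g u u = 0) ->
  \sum_(0 <= u < N) \sum_(0 <= v < N) g u v =
  2 * \sum_(0 <= u < N) \sum_(u.+1 <= v < N) g u v.
Proof.
move=> gC g0; elim: N => [|N IHN]; first by rewrite !big_geq.
have -> : \sum_(0 <= u < N.+1) \sum_(u.+1 <= v < N.+1) g u v =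
    \sum_(0 <= u < N) (\sum_(u.+1 <= v < N) g u v + g u N).
  rewrite big_nat_recr //= [X in _ + X]big_geq // addn0.
  by apply: eq_big_nat => u /andP[_ ltuN]; rewrite big_nat_recr.
rewrite big_nat_recr //= (big_nat_recr N) //= g0 addn0.
under eq_bigr do rewrite big_nat_recr //=.
rewrite !big_split /= IHN; under [X in _ + X]eq_bigr do rewrite gC.
lia.
Qed.

Lemma sum_nat_blocks n (F : nat -> nat) :
  \sum_(0 <= a < 5 * n) F a = \sum_(0 <= k < n) \sum_(0 <= i < 5) F (5 * k + i).
Proof.
elim: n => [|n IHn]; first by rewrite !big_geq.
rewrite [RHS]big_nat_recr //= -IHn (_ : 5 * n.+1 = (5 * n).+4.+1); last by lia.
rewrite !(big_nat_recr (5 * n).+4, big_nat_recr (5 * n).+3, big_nat_recr (5 * n).+2,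
  big_nat_recr (5 * n).+1, big_nat_recr (5 * n)) //=.
by rewrite unlock /= !addnS !addn0 -!addnA.
Qed.

(** * Distance in the 5-cycle, as the shorter of the two arcs *)

Definition cyc5 (i j : nat) : nat := minn ((i + 5 - j) %% 5) ((j + 5 - i) %% 5).

Ltac case5 i := case: i => [|[|[|[|[|i]]]]] //.

Lemma cyc5C i j : cyc5 i j = cyc5 j i.
Proof. by rewrite /cyc5 minnC. Qed.

Lemma cyc5_eq0 i j : i < 5 -> j < 5 -> (cyc5 i j == 0) = (i == j).
Proof. by case5 i; case5 j. Qed.

Lemma cyc5_le2 i j : i < 5 -> j < 5 -> cyc5 i j <= 2.
Proof. by case5 i; case5 j. Qed.

Definition cyc_adj i j := (j == i.+1 %% 5) || (i == j.+1 %% 5).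

Lemma cyc5_adj i j x : i < 5 -> j < 5 -> x < 5 -> cyc_adj i j ->
  cyc5 i x <= (cyc5 j x).+1.
Proof. by case5 i; case5 j; case5 x. Qed.

Lemma cyc5_descent i x : i < 5 -> x < 5 -> i != x ->
  exists j, [/\ j < 5, cyc_adj i j & cyc5 i x = (cyc5 j x).+1].
Proof.
case5 i; case5 x => _ _ _;
  solve [by exists 0 | by exists 1 | by exists 2 | by exists 3 | by exists 4].
Qed.

Lemma sum_cyc5 x : x < 5 -> \sum_(0 <= i < 5) cyc5 x i = 6.
Proof. by rewrite unlock; case5 x. Qed.

(** * Distances in a pentagonal chain *)

Section Chain.
Variables (n u1 : nat) (ex : nat -> nat).
Local Notation e := (pent_exit u1 ex).
Hypothesis e_lt5 : forall k, e k < 5.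

(* The vertex of pentagon [m] closest to [a]. *)
Definition proj m a := if a %/ 5 == m then a %% 5 else if a %/ 5 < m then 0 else e m.

(* The boolean summand says that [a] and [b] lie on different sides of the
   bridge that leaves pentagon [m]. *)
Definition pdist_term m a b :=
  cyc5 (proj m a) (proj m b) + ((a %/ 5 <= m) (+) (b %/ 5 <= m)).

Definition pdist a b := \sum_(0 <= m < n) pdist_term m a b.

Lemma proj_lt5 m a : proj m a < 5.
Proof. by rewrite /proj; case: ifP => _; [rewrite ltn_mod | case: ifP]. Qed.

Lemma divmod5_eq a b : a %/ 5 = b %/ 5 -> a %% 5 = b %% 5 -> a = b.
Proof. by move=> ed em; rewrite (divn_eq a 5) ed em -divn_eq. Qed.

Lemma div5_lt a : a < 5 * n -> a %/ 5 < n.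
Proof. by rewrite ltn_divLR // mulnC. Qed.

Lemma pdistC a b : pdist a b = pdist b a.
Proof. by apply: eq_bigr => m _; rewrite /pdist_term cyc5C addbC. Qed.

Lemma pdist_eq0 a b : a < 5 * n -> b < 5 * n -> (pdist a b == 0) = (a == b).
Proof.
move=> lta ltb; apply/idP/eqP => [|->]; last first.
  rewrite /pdist big1 // => m _; rewrite /pdist_term addbb addn0.
  by apply/eqP; rewrite cyc5_eq0 ?proj_lt5.
rewrite /pdist big_mkord sum_nat_eq0 => /forall_inP h.
have {}h m : m < n -> proj m a = proj m b /\ (a %/ 5 <= m) = (b %/ 5 <= m).
  move=> ltmn; have := h (Ordinal ltmn) isT.
  rewrite addn_eq0 cyc5_eq0 ?proj_lt5 //= => /andP[/eqP-> ].
  by case: (a %/ 5 <= m); case: (b %/ 5 <= m).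
(* The bridge bits at the pentagons of [a] and of [b] give both inequalities between the two
   indices; the projections then identify the positions. *)
have [pa qa] := h _ (div5_lt lta); have [pb qb] := h _ (div5_lt ltb).
have ed : a %/ 5 = b %/ 5 by lia.
by apply: divmod5_eq => //; move: pa; rewrite /proj ed eqxx.
Qed.

(** A pentagon contributes at most 2 and its outgoing bridge at most 1. The bound keeps the value
    inside the range searched by [gdist]. *)
Lemma pdist_lt a b : 0 < n -> pdist a b < 5 * n.
Proof.
move=> n0; apply: (@leq_ltn_trans (\sum_(0 <= m < n) 3)); last first.
  by rewrite sum_nat_const_nat; lia.
apply: leq_sum => m _; have := cyc5_le2 (proj_lt5 m a) (proj_lt5 m b).
by rewrite /pdist_term; case: (_ (+) _) => /=; lia.
Qed.

Lemma pdistD1 k a b : k < n ->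
  pdist a b = pdist_term k a b + \sum_(0 <= m < n | m != k) pdist_term m a b.
Proof.
by move=> ltkn; rewrite /pdist (bigD1_seq k) ?mem_index_iota ?iota_uniq.
Qed.

Lemma proj_cyc a b m : a %/ 5 = b %/ 5 -> m != a %/ 5 -> proj m a = proj m b.
Proof. by rewrite /proj eq_sym => -> /negPf->. Qed.

(** Inside one pentagon only the term of that pentagon changes. The balance has sums on both sides
    to avoid truncated subtraction. *)
Lemma pdist_cyc a b c : a < 5 * n -> a %/ 5 = b %/ 5 ->
  pdist a c + cyc5 (b %% 5) (proj (a %/ 5) c) =
  pdist b c + cyc5 (a %% 5) (proj (a %/ 5) c).
Proof.
move=> lta ed; rewrite !(pdistD1 _ _ (div5_lt lta)).
rewrite (eq_bigr (fun m => pdist_term m b c)); last first.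
  by move=> m nm; rewrite /pdist_term (proj_cyc ed nm) ed.
have projE x : proj (x %/ 5) x = x %% 5 by rewrite /proj eqxx.
rewrite /pdist_term -{1}ed projE ed projE; move: (\sum_(_ <- _ | _) _) => S.
by lia.
Qed.

Lemma proj_link a b m : pent_link u1 ex a b -> proj m a = proj m b.
Proof.
case/and3P=> /eqP eb /eqP b0 /eqP ea; rewrite /proj eb b0.
case: (ltngtP (a %/ 5) m) => [h|h|<-]; repeat case: ifP; lia.
Qed.

(** Both ends of a bridge project to the same vertex of every pentagon, so only the crossing bit of
    this bridge changes. *)
Lemma pdist_link a b c : pent_link u1 ex a b -> b < 5 * n ->
  pdist a c + (c %/ 5 <= a %/ 5) = pdist b c + (b %/ 5 <= c %/ 5).
Proof.
move=> ab /div5_lt; case/and3P: (ab) => /eqP eb _ _ ltb.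
have lta : a %/ 5 < n by lia.
rewrite !(pdistD1 _ _ lta).
rewrite (eq_bigr (fun m => pdist_term m b c)); last first.
  move=> m nm; rewrite /pdist_term (proj_link _ ab) eb.
  by congr (_ + (_ (+) _)); move: nm; lia.
rewrite /pdist_term (proj_link _ ab) eb leqnn ltnn /=.
move: (\sum_(_ <- _ | _) _) => S.
by case: (leqP (c %/ 5)) => h /=; lia.
Qed.

Lemma pent_cycE a b : pent_cyc a b -> a %/ 5 = b %/ 5 /\ cyc_adj (a %% 5) (b %% 5).
Proof. by case/andP=> /eqP. Qed.

Lemma pdist_adj a b c : a < 5 * n -> c < 5 * n -> b < 5 * n ->
  pent_adj n u1 ex a b -> pdist a c <= (pdist b c).+1.
Proof.
move=> lta ltc ltb /and3P[_ _ /or3P[/pent_cycE[ed ab]|ab|ba]].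
- have := pdist_cyc c lta ed.
  by have := cyc5_adj (ltn_pmod a _) (ltn_pmod b _) (proj_lt5 (a %/ 5) c) ab; lia.
- by have := pdist_link c ab ltb; do 2!case: leqP => //=; lia.
- by have := pdist_link c ba lta; do 2!case: leqP => //=; lia.
Qed.

(** A geodesic first walks inside the pentagon of [a] to the projection of [c]; once there, [a] is
    the exit or [x_1], and the next step crosses a bridge. *)
Lemma pdist_descent a c : a < 5 * n -> c < 5 * n -> a != c ->
  exists b, [/\ b < 5 * n, pent_adj n u1 ex a b & pdist a c = (pdist b c).+1].
Proof.
move=> lta ltc neq; have ltk := div5_lt lta; have ltl := div5_lt ltc.
have [eqp|] := eqVneq (a %% 5) (proj (a %/ 5) c); last first.
  case/cyc5_descent; rewrite ?ltn_mod ?proj_lt5 // => j [ltj aj Dj].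
  have ed : (a %/ 5 * 5 + j) %/ 5 = a %/ 5 by lia.
  have em : (a %/ 5 * 5 + j) %% 5 = j by lia.
  have ltb : a %/ 5 * 5 + j < 5 * n by lia.
  exists (a %/ 5 * 5 + j); split=> //.
    rewrite /pent_adj lta ltb /pent_cyc ed em eqxx /=; apply/or3P/Or31; exact: aj.
  by have := pdist_cyc c lta (esym ed); rewrite em; lia.
have [ltac|ltca|eqac] := ltngtP (a %/ 5) (c %/ 5).
- have ea : a %% 5 = e (a %/ 5) by rewrite eqp /proj gtn_eqF // ltnNge ltnW.
  have ab : pent_link u1 ex a ((a %/ 5).+1 * 5).
    by rewrite /pent_link mulnK // modnMl ea !eqxx.
  have ltb : (a %/ 5).+1 * 5 < 5 * n by lia.
  (* The witness is [x_1] of the next pentagon. *)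
  exists ((a %/ 5).+1 * 5); split=> //.
    by rewrite /pent_adj lta ltb ab orbT.
  by have := pdist_link c ab ltb; rewrite mulnK // ltac (leqNgt (c %/ 5)) ltac /=; lia.
- have a0 : a %% 5 = 0 by rewrite eqp /proj ltn_eqF ?ltca.
  (* Here [b] is the exit of the previous pentagon. *)
  have lte := e_lt5 (a %/ 5).-1; set b := (a %/ 5).-1 * 5 + e (a %/ 5).-1.
  have ed : b %/ 5 = (a %/ 5).-1 by rewrite /b; lia.
  have em : b %% 5 = e (a %/ 5).-1 by rewrite /b; lia.
  have ltb : b < 5 * n by rewrite /b; lia.
  have ba : pent_link u1 ex b a.
    by rewrite /pent_link ed em a0 !eqxx prednK ?eqxx //; lia.
  exists b; split=> //; first by rewrite /pent_adj lta ltb ba !orbT.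
  have := pdist_link c ba lta; rewrite ed (leqNgt (a %/ 5)) ltca /=.
  have -> : c %/ 5 <= (a %/ 5).-1 by lia.
  by lia.
- case/eqP: neq; apply: divmod5_eq => //.
  by rewrite eqp /proj eqac eqxx.
Qed.

Lemma gdist_pent a b : 0 < n -> a < 5 * n -> b < 5 * n ->
  gdist (pent_adj n u1 ex) (5 * n) a b = pdist a b.
Proof.
move=> n0 lta ltb; apply: gdistE => //; first exact: pdist_eq0.
- by move=> u v w; apply: pdist_adj.
- exact: pdist_descent.
- exact: pdist_lt.
Qed.

(** * Degrees and the Gutman index of a fixed chain *)

Definition pdeg k i := 2 + ((0 < k) && (i == 0)) + ((k.+1 < n) && (i == e k)).

Lemma sum_pred1_nat k m A : \sum_(0 <= l < m) (l == k) * A = (k < m) * A.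
Proof.
elim: m => [|m IHm]; first by rewrite big_geq.
by rewrite big_nat_recr //= IHm; case: (ltngtP m k) => h; do 2?case: leqP => //=; lia.
Qed.

Lemma sum5E (F : nat -> nat) :
  \sum_(0 <= i < 5) F i = F 0 + F 1 + F 2 + F 3 + F 4.
Proof. by rewrite unlock /= addn0 !addnA. Qed.

(** Counts neighbours pentagon by pentagon: two cycle neighbours, one across the outgoing bridge,
    one across the incoming bridge. At [k = 0] the truncated [k.-1] is harmless because of the guard
    [0 < k]. *)
Lemma sum_pent_adj k l i : k < n -> l < n -> i < 5 ->
  \sum_(0 <= j < 5) pent_adj n u1 ex (5 * k + i) (5 * l + j) =
  (l == k) * 2 + (l == k.+1) * ((k.+1 < n) && (i == e k)) +
  (l == k.-1) * ((0 < k) && (i == 0)).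
Proof.
move=> ltk ltl lti; have lte := e_lt5 l.
have modE x y : y < 5 -> (5 * x + y) %% 5 = y by lia.
have divE x y : y < 5 -> (5 * x + y) %/ 5 = x by lia.
have adjE j : j < 5 -> pent_adj n u1 ex (5 * k + i) (5 * l + j) =
    (l == k) * cyc_adj i j + (l == k.+1) * ((i == e k) * (j == 0)) +
    (l.+1 == k) * ((i == 0) * (j == e l)) :> nat.
  move=> ltj; rewrite /pent_adj /pent_cyc /pent_link /cyc_adj !modE // !divE //.
  have -> : 5 * k + i < 5 * n by lia.
  have -> : 5 * l + j < 5 * n by lia.
  rewrite (eq_sym k l) (eq_sym k l.+1) /=.
  have [eqlk|_] := eqVneq l k.
    have -> : (l == k.+1) = false by lia.
    have -> : (l.+1 == k) = false by lia.
    by rewrite orbF !mul0n !addn0 mul1n.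
  have [->|_] := eqVneq l k.+1; last by do !case: eqP.
  have -> : (k.+2 == k) = false by lia.
  by do !case: eqP.
under eq_big_nat => j /andP[_ ltj] do rewrite adjE //.
rewrite !big_split /= -!big_distrr /=.
congr (_ + _ + _).
- by rewrite sum5E; move: lti {adjE}; case5 i.
- by rewrite sum5E; case: (eqVneq l k.+1) => [<-|_] //; rewrite ltl; case: eqP.
- rewrite [X in _ * (_ * X)](_ : _ = 1); last first.
    by rewrite sum5E; move: (e l) lte => x; case5 x.
  by case: (eqVneq l.+1 k) => [<-|h] /=; [rewrite eqxx; case: eqP | case: posnP; lia].
Qed.

Lemma gdeg_pent k i : k < n -> i < 5 ->
  gdeg (pent_adj n u1 ex) (5 * n) (5 * k + i) = pdeg k i.
Proof.
move=> ltk lti; rewrite /gdeg -sum1_count big_mkcond /=.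
rewrite -[in LHS](subn0 (5 * n)) -/(index_iota _ _).
rewrite (eq_bigr (fun b => nat_of_bool (pent_adj n u1 ex (5 * k + i) b))); last first.
  by move=> b _; case: ifP.
rewrite sum_nat_blocks; under eq_big_nat => l /andP[_ ltl] do rewrite sum_pent_adj //.
rewrite !big_split /= !sum_pred1_nat /pdeg ltk.
have -> : k.-1 < n by lia.
by case: (k.+1 < n); lia.
Qed.

Lemma sum_pdeg k (phi : nat -> nat) :
  \sum_(0 <= i < 5) pdeg k i * phi i =
  2 * \sum_(0 <= i < 5) phi i + (0 < k) * phi 0 + (k.+1 < n) * phi (e k).
Proof.
rewrite !sum5E /pdeg; move: (e k) (e_lt5 k) => x.
by case: (0 < k); case: (k.+1 < n); case5 x => _ /=; lia.
Qed.

(** A pentagon has degree sum 10 from its cycle and 1 per bridge end. The first one lacks an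
    incoming bridge; the far end of the bridge into pentagon [m] makes up for it. *)
Lemma sum_left m : \sum_(0 <= k < m) (11 + (0 < k)) + (0 < m) = 12 * m.
Proof.
elim: m => [|m IHm]; first by rewrite big_geq.
by rewrite big_nat_recr //=; lia.
Qed.

Lemma sum_right m : m < n ->
  \sum_(m.+1 <= k < n) (11 + (k.+1 < n)) + (m.+1 < n) = 12 * (n.-1 - m).
Proof.
move=> ltmn; have [r ->] : exists r, n = m.+1 + r by exists (n - m.+1); lia.
have -> : (m.+1 + r).-1 - m = r by lia.
elim: r m {ltmn} => [|r IHr] m; first by rewrite big_geq //; lia.
have := IHr m.+1; rewrite addnS -addSn => IHr'.
by rewrite big_ltn //; lia.
Qed.

(* Everything left of pentagon [m], together with the bridge end at [x_1], has
   total degree [12 m] and projects to [x_1]; symmetrically for the exit. *)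
Lemma sum_deg_proj m (phi : nat -> nat) : m < n ->
  \sum_(0 <= a < 5 * n) gdeg (pent_adj n u1 ex) (5 * n) a * phi (proj m a) =
  2 * \sum_(0 <= i < 5) phi i + 12 * m * phi 0 + 12 * (n.-1 - m) * phi (e m).
Proof.
move=> ltmn; rewrite sum_nat_blocks.
(* The value of [phi] at the projection of vertex [i] of pentagon [k]; it is constant on every
   pentagon other than [m]. *)
pose psi k i := if k == m then phi i else if k < m then phi 0 else phi (e m).
have blockE k : k < n ->
  \sum_(0 <= i < 5) gdeg (pent_adj n u1 ex) (5 * n) (5 * k + i) * phi (proj m (5 * k + i)) =
  2 * \sum_(0 <= i < 5) psi k i + (0 < k) * psi k 0 + (k.+1 < n) * psi k (e k).
  move=> ltk; rewrite -sum_pdeg; apply: eq_big_nat => i /andP[_ lti].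
  rewrite gdeg_pent // /proj /psi.
  have -> : (5 * k + i) %% 5 = i by lia.
  have -> : (5 * k + i) %/ 5 = k by lia.
  by case: eqP => // _; case: ifP.
under eq_big_nat => k /andP[_ ltk] do rewrite blockE //.
rewrite (big_cat_nat (n := m)) //=; last exact: ltnW.
rewrite (big_ltn ltmn).
have -> : \sum_(0 <= k < m)
   (2 * \sum_(0 <= i < 5) psi k i + (0 < k) * psi k 0 + (k.+1 < n) * psi k (e k)) =
   (\sum_(0 <= k < m) (11 + (0 < k))) * phi 0.
  rewrite big_distrl /=; apply: eq_big_nat => k /andP[_ ltk].
  rewrite sum5E /psi ltk ltn_eqF //.
  have -> : k.+1 < n by lia.
  by lia.
have -> : \sum_(m.+1 <= k < n)
   (2 * \sum_(0 <= i < 5) psi k i + (0 < k) * psi k 0 + (k.+1 < n) * psi k (e k)) =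
   (\sum_(m.+1 <= k < n) (11 + (k.+1 < n))) * phi (e m).
  rewrite big_distrl /=; apply: eq_big_nat => k /andP[ltk _].
  rewrite sum5E /psi (ltnNge k) (ltnW ltk) gtn_eqF //=.
  have -> : 0 < k by lia.
  by lia.
rewrite -(sum_left m) -(sum_right ltmn) !mulnDl.
have psim i : psi m i = phi i by rewrite /psi eqxx.
by rewrite !psim (eq_bigr _ (fun i _ => psim i)); lia.
Qed.

(** The [m.+1] pentagons would give 12 each, but the first has no incoming bridge:
    [12 * m.+1 - 1]. *)
Lemma sum_deg_left m : m.+1 < n ->
  \sum_(0 <= a < 5 * n) gdeg (pent_adj n u1 ex) (5 * n) a * (a %/ 5 <= m) = 12 * m + 11.
Proof.
move=> ltmn; rewrite sum_nat_blocks
  (eq_big_nat _ _ (F2 := fun k => (k <= m) * (11 + (0 < k)))).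
  rewrite (big_cat_nat (n := m.+1)) //=; last exact: ltnW.
  rewrite [X in _ + X]big_nat_cond [X in _ + X]big1 ?addn0; last first.
    by move=> k; rewrite andbT => /andP[ltk _]; rewrite leqNgt ltk.
  under eq_big_nat => k /andP[_ ltk] do rewrite -ltnS ltk mul1n.
  by have := sum_left m.+1; lia.
move=> k /andP[_ ltk].
rewrite (eq_big_nat _ _ (F2 := fun i => pdeg k i * (k <= m))).
  rewrite sum_pdeg sum5E; case: leqP => h; last by lia.
  have -> : k.+1 < n by lia.
  by lia.
by move=> i /andP[_ lti]; rewrite gdeg_pent //; congr (_ * (_ <= _)); lia.
Qed.

Lemma sum_deg_right m : m.+1 < n ->
  \sum_(0 <= a < 5 * n) gdeg (pent_adj n u1 ex) (5 * n) a * (m < a %/ 5) =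
  12 * (n.-2 - m) + 11.
Proof.
move=> ltmn; rewrite sum_nat_blocks
  (eq_big_nat _ _ (F2 := fun k => (m < k) * (11 + (k.+1 < n)))).
  rewrite (big_cat_nat (n := m.+1)) //=; last exact: ltnW.
  rewrite [X in X + _]big_nat_cond [X in X + _]big1 ?add0n; last first.
    by move=> k; rewrite andbT => /andP[_ ltk]; rewrite ltnNge -ltnS ltk.
  under eq_big_nat => k /andP[ltk _] do rewrite ltk mul1n.
  by have := sum_right (ltnW ltmn); rewrite ltmn; lia.
move=> k /andP[_ ltk].
rewrite (eq_big_nat _ _ (F2 := fun i => pdeg k i * (m < k))).
  rewrite sum_pdeg sum5E; case: leqP => h; first by lia.
  have -> : 0 < k by lia.
  by lia.
by move=> i /andP[_ lti]; rewrite gdeg_pent //; congr (_ * (_ < _)); lia.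
Qed.

Local Notation deg := (gdeg (pent_adj n u1 ex) (5 * n)).

Lemma sum_deg_cyc5 m : m < n ->
  \sum_(0 <= a < 5 * n) \sum_(0 <= b < 5 * n)
     deg a * deg b * cyc5 (proj m a) (proj m b) =
  2 * (60 + 144 * n.-1 + 144 * (m * (n.-1 - m)) * cyc5 0 (e m)).
Proof.
move=> ltmn; set r := n.-1 - m; have lte := e_lt5 m.
(* The inner sum over [b], as a function of the projection of [a]; the constant 12 is twice the row
   sum 0+1+2+2+1 of [cyc5]. Applying [sum_deg_proj] again handles the sum over [a]. *)
pose phi x := 12 + 12 * m * cyc5 0 x + 12 * r * cyc5 (e m) x.
rewrite (eq_bigr (fun a => deg a * phi (proj m a))); last first.
  move=> a _; under eq_bigr do rewrite -mulnA.
  rewrite -big_distrr (sum_deg_proj _ ltmn) sum_cyc5 ?proj_lt5 //.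
  by rewrite /phi ![cyc5 _ (proj m a)]cyc5C.
rewrite sum_deg_proj // /phi !big_split /= -!big_distrr /= !sum_cyc5 //.
have cycxx x : x < 5 -> cyc5 x x = 0 by case5 x.
rewrite !cycxx // (cyc5C (e m) 0) -/r sum_nat_const_nat.
have -> : n.-1 = m + r by rewrite /r; lia.
by rewrite subn0 !muln0 !addn0; move: (cyc5 _ _) => d; clear; nia.
Qed.

Lemma sum_deg_bridge m : m.+1 < n ->
  \sum_(0 <= a < 5 * n) \sum_(0 <= b < 5 * n)
     deg a * deg b * ((a %/ 5 <= m) (+) (b %/ 5 <= m)) =
  2 * ((12 * m + 11) * (12 * (n.-2 - m) + 11)).
Proof.
move=> ltmn; rewrite -sum_deg_left // -sum_deg_right //.
(* The factor 2 counts the ordered pairs left-right and right-left. *)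
have dblE x y : 2 * (x * y) = x * y + y * x by lia.
rewrite dblE !big_distrlr /= -big_split /=.
apply: eq_bigr => a _; rewrite -big_split; apply: eq_bigr => b _ /=.
by case: (leqP (a %/ 5) m); case: (leqP (b %/ 5) m) => _ _ /=; lia.
Qed.

Lemma gutman_pent : 0 < n ->
  gutman (pent_adj n u1 ex) (5 * n) =
  \sum_(0 <= m < n) (60 + 144 * n.-1 + 144 * (m * (n.-1 - m)) * cyc5 0 (e m)) +
  \sum_(0 <= m < n.-1) (12 * m + 11) * (12 * (n.-2 - m) + 11).
Proof.
move=> n0; pose g a b := deg a * deg b * pdist a b.
have -> : gutman (pent_adj n u1 ex) (5 * n) =
    \sum_(0 <= a < 5 * n) \sum_(a.+1 <= b < 5 * n) g a b.
  apply: eq_big_nat => a /andP[_ lta]; apply: eq_big_nat => b /andP[_ ltb].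
  by rewrite gdist_pent.
(* Doubling passes to ordered pairs, where the sum over pentagons can be pulled outside. *)
apply/eqP; rewrite -(eqn_pmul2l (isT : 0 < 2)) -sum_sym_pairs; last 2 first.
- by move=> a b; rewrite /g pdistC (mulnC (deg a)).
- move=> a; rewrite /g /pdist big1 ?muln0 // => m _.
  by rewrite /pdist_term addbb addn0; apply/eqP; rewrite cyc5_eq0 ?proj_lt5.
have -> : \sum_(0 <= a < 5 * n) \sum_(0 <= b < 5 * n) g a b =
  \sum_(0 <= m < n) (\sum_(0 <= a < 5 * n) \sum_(0 <= b < 5 * n)
     deg a * deg b * pdist_term m a b).
  rewrite [RHS]exchange_big_nat /=; apply: eq_bigr => a _.
  rewrite [RHS]exchange_big_nat /=; apply: eq_bigr => b _.
  by rewrite /g /pdist big_distrr.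
have splitE m : \sum_(0 <= a < 5 * n) \sum_(0 <= b < 5 * n)
     deg a * deg b * pdist_term m a b =
  \sum_(0 <= a < 5 * n) \sum_(0 <= b < 5 * n)
     deg a * deg b * cyc5 (proj m a) (proj m b) +
  \sum_(0 <= a < 5 * n) \sum_(0 <= b < 5 * n)
     deg a * deg b * ((a %/ 5 <= m) (+) (b %/ 5 <= m)).
  rewrite -big_split; apply: eq_bigr => a _ /=.
  by rewrite -big_split; apply: eq_bigr => b _ /=; rewrite -mulnDr.
rewrite (eq_bigr _ (fun m _ => splitE m)) big_split /= mulnDr.
under eq_big_nat => m /andP[_ ltm] do rewrite sum_deg_cyc5 //.
rewrite -big_distrr /= eqn_add2l.
have recE (F : nat -> nat) : \sum_(0 <= m < n) F m = \sum_(0 <= m < n.-1) F m + F n.-1.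
  by rewrite -{1}(prednK n0) big_nat_recr.
rewrite recE.
(* No bridge leaves the last pentagon: every vertex has index at most [n.-1], so its bit is always
   false. *)
rewrite [X in _ + X](_ : _ = 0) ?addn0; last first.
  rewrite big_nat big1 // => a /andP[_ lta]; rewrite big_nat big1 // => b /andP[_ ltb].
  have := div5_lt lta; have := div5_lt ltb.
  by rewrite -{1 2}(prednK n0) !ltnS => -> ->; rewrite muln0.
rewrite big_distrr /=; apply/eqP; apply: eq_big_nat => m /andP[_ ltm].
by apply: sum_deg_bridge; lia.
Qed.

End Chain.

(** * Averaging over the random exits *)

Local Open Scope ring_scope.

Lemma sum_tuple_prod (R : comNzRingType) (T : finType) k (F : 'I_k -> T -> R) :
  \sum_(c : k.-tuple T) \prod_i F i (tnth c i) = \prod_i \sum_x F i x.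
Proof.
rewrite bigA_distr_bigA /=.
rewrite (reindex (fun f : {ffun 'I_k -> T} => [tuple f i | i < k])) /=.
  by apply: eq_bigr => f _; apply: eq_bigr => i _; rewrite tnth_mktuple.
exists (fun c : k.-tuple T => [ffun i => tnth c i]) => [f|c] _.
  by apply/ffunP => i; rewrite ffunE tnth_mktuple.
by apply: eq_from_tnth => i; rewrite tnth_mktuple ffunE.
Qed.

Section Product.
Variables (R : comNzRingType) (T : finType) (k : nat) (w : T -> R).
Hypothesis w1 : \sum_x w x = 1.

Lemma sum_tuple_weight : \sum_(c : k.-tuple T) \prod_(x <- c) w x = 1.
Proof.
under eq_bigr do rewrite big_tuple.
by rewrite (sum_tuple_prod (fun=> w)) big1.
Qed.

(** The marginal law of one coordinate: by independence the other factors sum to 1. *)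
Lemma sum_tuple_coord (f : T -> R) (j : 'I_k) :
  \sum_(c : k.-tuple T) (\prod_(x <- c) w x) * f (tnth c j) = \sum_x w x * f x.
Proof.
pose F i x := w x * (if i == j then f x else 1).
transitivity (\sum_(c : k.-tuple T) \prod_i F i (tnth c i)).
  apply: eq_bigr => c _; rewrite big_tuple big_split /=; congr (_ * _).
  by rewrite (bigD1 j) //= eqxx big1 ?mulr1 // => i /negPf->.
rewrite sum_tuple_prod (bigD1 j) //= [X in _ * X]big1 ?mulr1.
  by apply: eq_bigr => x _; rewrite /F eqxx.
by move=> i /negPf nij; rewrite /F; under eq_bigr do rewrite nij mulr1.
Qed.

End Product.

(** * Closed forms of the polynomial sums *)

Section Polynomial.
Variable R : realFieldType.
Implicit Type a : R.

Lemma sum_mul_sub a k : \sum_(0 <= m < k) m%:R * (a - m%:R) =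
  a * k%:R * (k%:R - 1) / 2 - (k%:R - 1) * k%:R * (2 * k%:R - 1) / 6.
Proof.
elim: k => [|k IHk]; first by rewrite big_geq //; field.
by rewrite big_nat_recr //= IHk -natr1; field.
Qed.

(** With [a] equal to the number of bridges, [12 * (a - m) - 1] is the right-hand degree sum without
    truncation. Keeping [a] apart from [k] leaves the summand fixed during the induction. *)
Lemma sum_bridges a k :
  \sum_(0 <= m < k) (12 * m%:R + 11) * (12 * (a - m%:R) - 1) =
  144 * (a * k%:R * (k%:R - 1) / 2 - (k%:R - 1) * k%:R * (2 * k%:R - 1) / 6)
  - 72 * k%:R * (k%:R - 1) + (132 * a - 11) * k%:R.
Proof.
elim: k => [|k IHk]; first by rewrite big_geq //; field.
by rewrite big_nat_recr //= IHk -natr1; field.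
Qed.

End Polynomial.

(** * Expected contribution of an exit and the final formula *)

Section Expectation.
Variables (R : realFieldType) (p1 : R).

Lemma sum_choice_weight : \sum_i choice_weight p1 i = 1.
Proof. by rewrite !big_ord_recl big_ord0 /choice_weight /=; field. Qed.

Lemma choice_pos_lt5 i : (choice_pos i < 5)%N.
Proof. by case: i => [[|[|[|[|]]]]]. Qed.

Lemma expected_cyc5 :
  \sum_i choice_weight p1 i * (cyc5 0 (choice_pos i))%:R = 2 - p1.
Proof.
rewrite !big_ord_recl big_ord0 /choice_weight /choice_pos /=.
have -> : cyc5 0 1 = 1%N by []. have -> : cyc5 0 4 = 1%N by [].
have -> : cyc5 0 2 = 2%N by []. have -> : cyc5 0 3 = 2%N by [].
by field.
Qed.

(** The factor [m * (N - m)] vanishes at both end pentagons, which have no random exit; elsewhere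
    the marginal law gives the mean [2 - p1]. *)
Lemma expected_exit N u1 m : (m <= N)%N ->
  \sum_(c : (N.+1 - 2).-tuple 'I_4) (\prod_(i <- c) choice_weight p1 i) *
    (144 * (m * (N - m)) * cyc5 0 (pent_exit u1 (chain_exit c) m))%:R =
  144 * (2 - p1) * (m%:R * (N%:R - m%:R)).
Proof.
move=> lemN; have [->|m_gt0] := posnP m.
  by rewrite big1 ?mul0r ?mulr0 // => c _; rewrite mul0n muln0 mul0n mulr0.
have [->|neq_mN] := eqVneq m N.
  by rewrite big1 ?subrr ?mulr0 // => c _; rewrite subnn !muln0 mul0n mulr0.
(* For an inner pentagon the choice is entry [m.-1], so [nth] never returns its default. *)
have ltj : (m.-1 < N.+1 - 2)%N by lia.
under eq_bigr => c _.
  rewrite /pent_exit gtn_eqF // /chain_exit.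
  rewrite -[m.-1]/(nat_of_ord (Ordinal ltj)) -tnth_nth natrM mulrCA.
  over.
rewrite -mulr_sumr (sum_tuple_coord sum_choice_weight
  (fun x => (cyc5 0 (choice_pos x))%:R) (Ordinal ltj)) expected_cyc5.
by rewrite !natrM natrB //; ring.
Qed.

End Expectation.

Theorem theorem2p1 (R : realFieldType) (p1 : R) (n u1 : nat) :
  0 <= p1 <= 1 -> (1 <= n)%N -> (u1 < 5)%N ->
  \sum_(c : (n - 2).-tuple 'I_4)
     (\prod_(i <- c) choice_weight p1 i) * (GutPG u1 c)%:R
  = (72 - 24 * p1) * n%:R ^+ 3 + (72 * p1 - 12) * n%:R ^+ 2
    + (1 - 48 * p1) * n%:R - 1.
Proof.
move=> _ n_gt0 ltu1; case: n n_gt0 => // N _.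
(* The bridge contribution, the same for every choice of exits. *)
pose B := (\sum_(0 <= m < N) (12 * m + 11) * (12 * (N.-1 - m) + 11))%N.
have gutE (c : (N.+1 - 2).-tuple 'I_4) : (GutPG u1 c)%:R =
    (N.+1 * (60 + 144 * N) + B)%:R +
    \sum_(0 <= m < N.+1)
      (144 * (m * (N - m)) * cyc5 0 (pent_exit u1 (chain_exit c) m))%:R :> R.
  rewrite /GutPG gutman_pent //= -/B.
    by rewrite big_split /= sum_nat_const_nat subn0 -natr_sum -natrD addnAC.
  by move=> k; rewrite /pent_exit /chain_exit; case: eqP; rewrite ?choice_pos_lt5.
have BE : B%:R = \sum_(0 <= m < N) (12 * m%:R + 11) * (12 * (N%:R - m%:R) - 1) :> R.
  rewrite natr_sum; apply: eq_big_nat => m /andP[_ ltmN].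
  (* Writing [N] as [(m + r).+1] removes the truncated subtractions. *)
  have [r ->] : exists r, N = (m + r).+1 by exists (N - m.+1)%N; lia.
  by rewrite /= addKn; ring.
under eq_bigr do rewrite gutE mulrDr mulr_sumr.
rewrite big_split -mulr_suml sum_tuple_weight ?sum_choice_weight // mul1r exchange_big /=.
under [X in _ + X]eq_big_nat => m /andP[_ lemN] do rewrite expected_exit //.
rewrite -mulr_sumr sum_mul_sub natrD BE sum_bridges natrM natrD natrM -natr1.
by field.
Qed.
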